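(* Let $n\ge2$ and let $M_1,\dots,M_n$ be positive integers with sum $Z$, and put $\mathbf{p}=(M_1/Z,\dots,M_n/Z)$. If $Z$ is prime and $2$ is a primitive root modulo $Z$, then any exact entropy-optimal sampler whose output distribution is $\mathbf{p}$ needs exactly $Z-1$ bits of precision; that is, the minimal precision of an entropy-optimal DDG tree with output distribution exactly $\mathbf{p}$ equals $Z-1$.
   Context: Random bit model: a source supplies independent fair bits. A sampler is described by its discrete distribution generating (DDG) tree $T=(S,r,n,c,\delta)$: $S\subseteq\mathbb{N}$ a set of nodes, $r\in S$ the root, $c:S\to\{1,\dots,n\}\cup\{\mathsf{branch}\}$ labels nodes as branch nodes or leaves labelled by outcomes, $\delta:S\times\{0,1\}\to S$ the transition function. Sampling starts at $r$; at a branch node a fresh fair bit $b$ is drawn and the sampler moves to $\delta(\text{node},b)$; at a leaf labelled $i$ it outputs $i$. $\delta$ may contain back-edges (so a finite $S$ may encode an infinite tree). The output distribution is $(p_1,\dots,p_n)$ with $p_i$ the probability of halting with output $i$. $T$ is entropy-optimal if its expected number of consumed bits is minimal among all DDG trees with the same output distribution. $T$ uses $k$ bits of precision if $S$ is finite and the longest simple path through $\delta$ from $r$ to any leaf has exactly $k$ edges. *)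

(* Defs.v *)
From HB Require Import structures.
From mathcomp Require Import all_boot all_order all_algebra.
From mathcomp Require Import all_classical all_reals all_analysis.

Set Implicit Arguments.
Unset Strict Implicit.
Unset Printing Implicit Defensive.

Import Order.TTheory GRing.Theory Num.Theory.

Local Open Scope classical_set_scope.
Local Open Scope ring_scope.

(* The tuple (S, r, n, c, delta).  The outcomes {1..n} are the elements of 'I_n,
   and [ddg_label s = None] encodes c(s) = branch.  The label and the transition
   function are total on nat, but only their values on S matter since S contains
   the root and is closed under transitions.  S may be infinite. *)
Record ddg (n : nat) := DDG {
  ddg_nodes : set nat;
  ddg_root : nat;
  ddg_label : nat -> option 'I_n;
  ddg_next : nat -> bool -> nat;
  ddg_root_in : ddg_nodes ddg_root;
  ddg_next_in : forall s b, ddg_nodes s -> ddg_nodes (ddg_next s b)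
}.

Section Sampling.
Context {n : nat} (T : ddg n).

(* The node occupied after k steps on the bit stream x; the sampler stays put
   once it has reached a leaf. *)
Fixpoint ddg_run (x : nat -> bool) (k : nat) : nat :=
  if k is k'.+1 then
    let s := ddg_run x k' in
    if ddg_label T s is None then ddg_next T s (x k') else s
  else ddg_root T.

Definition halts_with (x : nat -> bool) (i : 'I_n) : Prop :=
  exists k, ddg_label T (ddg_run x k) = Some i.

(* One bit is drawn at each step that starts from a branch node; the sum is +oo
   when the sampler never halts. *)
Definition consumed_bits (R : realType) (x : nat -> bool) : \bar R :=
  (\sum_(0 <= k <oo)
     ((ddg_label T (ddg_run x k) == None) : nat)%:R%:E)%E.

(* Leaves have no outgoing edges: the value of the transition function at a leaf
   is never used by the sampler. *)
Definition ddg_edge : rel nat :=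
  fun u v => (ddg_label T u == None) && [exists b, ddg_next T u b == v].

Definition simple_path_to_leaf (p : seq nat) : Prop :=
  [/\ path ddg_edge (ddg_root T) p,
      uniq (ddg_root T :: p)
    & ddg_label T (last (ddg_root T) p) <> None].

(* The number of edges of the path [ddg_root T :: p] is [size p]. *)
Definition uses_precision (k : nat) : Prop :=
  [/\ finite_set (ddg_nodes T),
      exists2 p, simple_path_to_leaf p & size p = k
    & forall p, simple_path_to_leaf p -> (size p <= k)%N].

End Sampling.

Section RandomBitModel.
Context d (Omega : measurableType d) (R : realType) (P : probability Omega R).
Variable X : nat -> {RV P >-> bool}.

Definition fair_bits : Prop :=
  forall k b, P (X k @^-1` [set b]) = (2^-1)%:E.

Definition independent_bits : Prop :=
  forall (J : seq nat) (B : nat -> set bool), uniq J ->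
    P (\bigcap_(k in [set` J]) (X k @^-1` B k)) =
    (\prod_(k <- J) P (X k @^-1` B k))%E.

Definition bit_stream (w : Omega) : nat -> bool := fun k => X k w.

Definition output_prob n (T : ddg n) (i : 'I_n) : \bar R :=
  P [set w | halts_with T (bit_stream w) i].

Definition expected_bits n (T : ddg n) : \bar R :=
  (\int[P]_w consumed_bits T R (bit_stream w))%E.

Definition entropy_optimal n (T : ddg n) : Prop :=
  forall T' : ddg n,
    (forall i, output_prob T' i = output_prob T i) ->
    (expected_bits T <= expected_bits T')%E.

Definition optimal_sampler_for n (p : 'I_n -> R) (T : ddg n) : Prop :=
  entropy_optimal T /\ forall i, output_prob T i = (p i)%:E.

Definition minimal_optimal_precision n (p : 'I_n -> R) (k : nat) : Prop :=
  (exists2 T : ddg n, optimal_sampler_for p T & uses_precision T k) /\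
  (forall (T : ddg n) (k' : nat),
     optimal_sampler_for p T -> uses_precision T k' -> (k <= k')%N).

End RandomBitModel.

(* g has multiplicative order totient m modulo m.  Meant for m > 1, since 'Z_m
   is the ring of integers modulo max(m, 2). *)
Definition primitive_root_modulo (g m : nat) : Prop :=
  (totient m).-primitive_root (g%:R : 'Z_m).

(* Main.v *)
Require Import Defs.
From HB Require Import structures.
From mathcomp Require Import all_boot all_order all_algebra.
From mathcomp Require Import all_classical all_reals all_analysis.
From mathcomp Require Import measurable_realfun zify lra ring.

Set Implicit Arguments.
Unset Strict Implicit.
Unset Printing Implicit Defensive.

Import Order.TTheory GRing.Theory Num.Theory.
Import numFieldNormedType.Exports.

Local Open Scope ring_scope.

(* Let [m = Z - 1] be the order of 2 modulo [Z].  Among the [2 ^ k] bit strings of length [k], at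
   most [floor (2 ^ k * M i / Z)] lead to a leaf labelled [i]; since the expected number of bits is
   the sum over [k] of the probability of still being at a branch node, a tree is optimal exactly
   when all these bounds are attained, i.e. when the leaves labelled [i] sit at the depths given by
   the binary digits of [M i / Z] (Knuth and Yao).

   The digits have period [m], and at depth [m] such a tree has a single branch node, just as at
   depth 0.  Replacing that node by a back edge to the root gives a finite optimal tree whose
   simple paths have length at most [m].

   Conversely, in a finite optimal tree no state is reached twice at the same depth.  Hence no
   state lies on two distinct cycles: of the two children of a node of a cycle, only one leads back
   to the node.  Around a cycle of length [a] the output probabilities therefore satisfy
   [(2 ^ a - 1) * q s = combination of the q of the exits], so if [Z] divides no such [2 ^ a - 1],
   no output probability has [Z] in its denominator, which is absurd at the root.  So some cycle
   has length at least [m], and going to it, around it and out to a leaf is a simple path of length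
   at least [m]. *)

(** * Bit strings of a given length *)

Section Bitstrings.
Local Open Scope nat_scope.

Fixpoint bitstrings (k : nat) : seq (seq bool) :=
  if k is k'.+1 then map (cons false) (bitstrings k') ++ map (cons true) (bitstrings k')
  else [:: [::]].

Lemma mem_bitstrings k w : (w \in bitstrings k) = (size w == k).
Proof.
elim: k w => [|k IHk] [|b w] //=; rewrite mem_cat.
  by apply/negbTE; rewrite negb_or; apply/andP; split; apply/mapP => -[].
have map_cons c : (b :: w \in map (cons c) (bitstrings k)) = (b == c) && (size w == k).
  rewrite -IHk; apply/mapP/andP => [[v hv [-> ->]] //|[/eqP-> hw]].
  by exists w.
by rewrite !map_cons ?eqSS; case: b {map_cons}; rewrite /= ?orbF.
Qed.

Lemma count_bitstringsS k (F : pred (seq bool)) :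
  count F (bitstrings k.+1) =
  count (fun w => F (false :: w)) (bitstrings k) +
  count (fun w => F (true :: w)) (bitstrings k).
Proof. by rewrite /= count_cat !count_map. Qed.

Lemma size_bitstrings k : size (bitstrings k) = 2 ^ k.
Proof. by elim: k => //= k IHk; rewrite size_cat !size_map IHk addnn -mul2n expnS. Qed.

Lemma count_ge2 (T : eqType) (F : pred T) (s : seq T) x y :
  x \in s -> y \in s -> F x -> F y -> x != y -> 2 <= count F s.
Proof.
move=> xs ys Fx Fy xy; rewrite -size_filter.
apply: (@uniq_leq_size _ [:: x; y]) => [|z]; first by rewrite /= inE xy.
by rewrite !inE mem_filter => /orP[]/eqP->; rewrite ?Fx ?Fy.
Qed.

End Bitstrings.

(** * Counting the strings that lead from a state to a given kind of node *)

Section Counting.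
Local Open Scope nat_scope.
Context (n : nat) (T : ddg n).
Implicit Types (s t x y : nat) (v w : seq bool) (b : bool) (i : 'I_n).

Local Notation label := (ddg_label T).
Local Notation next := (ddg_next T).
Local Notation root := (ddg_root T).

Definition ddg_step s b := if label s is None then next s b else s.

Definition ddg_exec s w := foldl ddg_step s w.

Lemma ddg_runE (x : nat -> bool) k : ddg_run T x k = ddg_exec root (mkseq x k).
Proof.
elim: k => // k IHk.
by rewrite mkseqS /ddg_exec foldl_rcons -/(ddg_exec _ _) -IHk.
Qed.

Definition state_count k s (Q : pred nat) :=
  count (fun w => Q (ddg_exec s w)) (bitstrings k).

Definition branch_count k s := state_count k s (fun t => label t == None).
Definition leaf_count k s i := state_count k s (fun t => label t == Some i).

Lemma state_countS k s Q :
  state_count k.+1 s Q =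
  state_count k (ddg_step s false) Q + state_count k (ddg_step s true) Q.
Proof. exact: count_bitstringsS. Qed.

Lemma ddg_step_leaf s b : label s != None -> ddg_step s b = s.
Proof. by rewrite /ddg_step; case: (label s). Qed.

Lemma ddg_step_branch s b : label s = None -> ddg_step s b = next s b.
Proof. by rewrite /ddg_step => ->. Qed.

Lemma state_count_leaf k s Q : label s != None -> state_count k s Q = Q s * 2 ^ k.
Proof.
move=> hs; elim: k => [|k IHk]; first by rewrite /state_count /= addn0 muln1.
by rewrite state_countS !ddg_step_leaf // IHk expnS; lia.
Qed.

Lemma branch_leaf_count k s :
  branch_count k s + \sum_(i < n) leaf_count k s i = 2 ^ k.
Proof.
rewrite -size_bitstrings /branch_count /leaf_count /state_count.
elim: (bitstrings k) => [|w l IHl] /=; first by rewrite big1.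
rewrite big_split /= addnACA IHl -add1n; congr (_ + _).
case: (label _) => [j|]; last by rewrite big1.
rewrite (bigD1 j) //= eqxx big1 // => i ij.
by case: eqP => // -[ji]; rewrite ji eqxx in ij.
Qed.

Lemma state_count_exec_le k w s Q :
  state_count k (ddg_exec s w) Q <= state_count (size w + k) s Q.
Proof.
elim: w s => //= b w IHw s; rewrite addSn state_countS.
by case: b; apply: (leq_trans (IHw _)); rewrite ?leq_addl ?leq_addr.
Qed.

Fixpoint first_hit i s w : bool :=
  if w is b :: w' then (label s == None) && first_hit i (next s b) w'
  else label s == Some i.

(** A string that has already reached a leaf stays there under both one-bit extensions, whence the
    factor 2; the other strings arrive exactly with their last bit. *)
Lemma leaf_countS k s i :
  leaf_count k.+1 s i =
  2 * leaf_count k s i + count (first_hit i s) (bitstrings k.+1).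
Proof.
case hs: (label s == None); last first.
  rewrite /leaf_count !state_count_leaf ?hs // (eq_in_count (a2 := pred0)) ?count_pred0.
    by rewrite expnS; lia.
  by move=> [|b w]; rewrite mem_bitstrings //= hs //=.
elim: k s hs => [|k IHk] s hs; move/eqP: (hs) => es.
  by rewrite /leaf_count state_countS /state_count /= /ddg_step es /=; lia.
rewrite /leaf_count (state_countS k.+1 s) (state_countS k s) !ddg_step_branch //.
rewrite count_bitstringsS.
have step b : state_count k.+1 (next s b) (fun t => label t == Some i) =
  2 * state_count k (next s b) (fun t => label t == Some i) +
  count (fun w => first_hit i s (b :: w)) (bitstrings k.+1).
  rewrite /= es eqxx /=; case hb: (label (next s b) == None); first exact: IHk.
  rewrite !state_count_leaf ?hb // -[X in _ + X]/(count _ (bitstrings k.+1)).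
  rewrite (eq_in_count (a2 := pred0)) ?count_pred0 ?expnS; first lia.
  by move=> [|c w]; rewrite mem_bitstrings //= hb //=.
by rewrite !step; lia.
Qed.

(** Unlike [ddg_exec], a trail never idles at a leaf, so [size w] is its number of edges; unlike a
    path of [ddg_edge], it tells apart two bits that lead to the same child. *)
Fixpoint trail s w t : bool :=
  if w is b :: w' then (label s == None) && trail (next s b) w' t else s == t.

Lemma trail_exec s w t : trail s w t -> ddg_exec s w = t.
Proof.
by elim: w s => [|b w IHw] s /= => [/eqP//|/andP[/eqP hs /IHw]]; rewrite ddg_step_branch.
Qed.

Lemma trail_cat s v w t : trail s (v ++ w) t = trail s v (ddg_exec s v) && trail (ddg_exec s v) w t.
Proof.
elim: v s => [|b v IHv] s /=; first by rewrite eqxx.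
by case: eqP => //= hs; rewrite ddg_step_branch.
Qed.

Lemma trail_trans s v x w t : trail s v x -> trail x w t -> trail s (v ++ w) t.
Proof. by move=> sv xw; rewrite trail_cat (trail_exec sv) sv. Qed.

Lemma trail_first_hit s w t i : trail s w t -> label t = Some i -> first_hit i s w.
Proof.
by elim: w s => [|b w IHw] s /= => [/eqP-> ->|/andP[-> /IHw]]; rewrite ?eqxx // => h /h.
Qed.

Lemma trail_path s w t : trail s w t ->
  exists p, [/\ path (ddg_edge T) s p, last s p = t & size p = size w].
Proof.
elim: w s => [|b w IHw] s /= => [/eqP->|/andP[hs /IHw[p [pp lp sp]]]]; first by exists [::].
exists (next s b :: p); split=> //=; last by rewrite sp.
by rewrite pp /ddg_edge hs andbT; apply/existsP; exists b.
Qed.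

Lemma path_trail s p :
  path (ddg_edge T) s p -> exists2 w, trail s w (last s p) & size w = size p.
Proof.
elim: p s => [|x p IHp] s /=; first by exists [::] => /=.
case/andP=> /andP[hs /existsP[b /eqP hb]] /IHp[w hw sw].
by exists (b :: w); rewrite /= ?sw // hs hb.
Qed.

Definition reaches s t := exists w, trail s w t.

Lemma reachesP s t :
  reaches s t <-> exists2 p, path (ddg_edge T) s p & last s p = t.
Proof.
split=> [[w /trail_path[p [pp lp _]]]|[p /path_trail[w hw _] <-]]; first by exists p.
by exists w.
Qed.

Lemma reaches_refl s : reaches s s.
Proof. by exists [::] => /=. Qed.

Lemma reaches_trans s t x : reaches s t -> reaches t x -> reaches s x.
Proof. by move=> [v hv] [w hw]; exists (v ++ w); apply: trail_trans hw. Qed.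

Lemma reaches_next s b : label s = None -> reaches s (next s b).
Proof. by move=> hs; exists [:: b]; rewrite /= hs !eqxx. Qed.

Lemma reaches_nodes s t : reaches s t -> ddg_nodes T s -> ddg_nodes T t.
Proof.
move=> [w]; elim: w s => [|b w IHw] s /= => [/eqP-> //|/andP[_ /IHw h] hs].
by apply: h; apply: ddg_next_in.
Qed.

End Counting.

(** * The finite Knuth-Yao tree *)

Section OptimalTree.
Local Open Scope nat_scope.
Context (n : nat) (M : 'I_n -> nat) (Z m : nat).
Hypothesis (m_gt0 : 0 < m) (Z_gt0 : 0 < Z) (Z_sum : Z = \sum_(i < n) M i).
Hypothesis (M_ltZ : forall i, M i < Z) (Z_period : Z %| 2 ^ m - 1).

Definition residue k (i : 'I_n) := (2 ^ k * M i) %% Z.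

(* The binary expansion of [M i / Z] after the [k]-th digit is [residue k i / Z], so an
   optimal tree has [width k] branch nodes at depth [k]. *)
Definition width k := (\sum_(i < n) residue k i) %/ Z.

(** The outcomes whose binary digit number [k + 1] is 1; each gets a leaf at depth [k + 1]. *)
Definition leaves k : seq nat :=
  [seq val i | i <- enum 'I_n & Z <= 2 * residue k i].

(** The numbers below [n] serve as the leaves; each depth gets its own block of [n] numbers after
    them. *)
Definition node k j := n * k.+1 + j.

(** The children of a level are numbered consecutively by [c]: the first [width k.+1] are branch
    nodes, the others leaves. Reducing [k.+1] modulo [m] creates the back edge to the root. *)
Definition knuth_yao_next s (b : bool) :=
  if s < n then s else
  let k := (s %/ n).-1 in
  let c := 2 * (s %% n) + b in
  if c < width k.+1 then node (k.+1 %% m) c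
  else nth 0 (leaves k) (c - width k.+1).

Definition knuth_yao_nodes : set nat := `I_(n * m.+1).

Lemma residue_lt k i : residue k i < Z.
Proof. by rewrite ltn_mod. Qed.

Lemma residue0 i : residue 0 i = M i.
Proof. by rewrite /residue mul1n modn_small. Qed.

Lemma residue_period i : residue m i = residue 0 i.
Proof.
rewrite /residue mul1n; apply/eqP.
rewrite -[X in _ == X %[mod _]]mul1n eqn_mod_dvd ?leq_mul2r ?expn_gt0 ?orbT //.
by rewrite -mulnBl dvdn_mulr.
Qed.

(** One step of binary long division by [Z], the Boolean being the new digit. *)
Lemma residueS k i : 2 * residue k i = Z * (Z <= 2 * residue k i) + residue k.+1 i.
Proof.
have -> : residue k.+1 i = (2 * residue k i) %% Z.
  by rewrite /residue expnS modnMmr mulnA.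
have := residue_lt k i; case: (leqP Z (2 * residue k i)) => h hZ.
  suff -> : (2 * residue k i) %% Z = 2 * residue k i - Z by lia.
  have := modnDr (2 * residue k i - Z) Z; rewrite subnK // => ->.
  by rewrite modn_small; lia.
by rewrite modn_small //; lia.
Qed.

(** The numbers [2 ^ k * M i] add up to [2 ^ k * Z], so the division in [width] is exact. *)
Lemma sum_residue k : \sum_(i < n) residue k i = width k * Z.
Proof.
rewrite /width divnK //.
have : \sum_(i < n) 2 ^ k * M i =
       \sum_(i < n) (2 ^ k * M i) %/ Z * Z + \sum_(i < n) residue k i.
  by rewrite -big_split /=; apply: eq_bigr => i _; apply: divn_eq.
rewrite -big_distrr -big_distrl /= -Z_sum => e.
have : Z %| 2 ^ k * Z by rewrite dvdn_mull.
by rewrite e dvdn_addr // dvdn_mull.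
Qed.

Lemma width0 : width 0 = 1.
Proof.
rewrite /width (eq_bigr M) => [|i _]; last exact: residue0.
by rewrite -Z_sum divnn Z_gt0.
Qed.

Lemma width_period : width m = width 0.
Proof. by rewrite /width (eq_bigr (residue 0)) // => i _; apply: residue_period. Qed.

Lemma n_gt0 : 0 < n.
Proof. by case: n M Z_sum => // M' Z0; move: Z_gt0; rewrite Z0 big_ord0. Qed.

(** This bound lets the branch nodes of a level fit into a block of [n] numbers. *)
Lemma width_lt k : width k < n.
Proof.
have nZ : n * Z = \sum_(i < n) Z by rewrite sum_nat_const card_ord.
rewrite -(ltn_pmul2r Z_gt0) -sum_residue nZ.
rewrite (bigD1 (Ordinal n_gt0)) //= [X in _ < X](bigD1 (Ordinal n_gt0)) //=.
rewrite -addSn leq_add ?residue_lt //; apply: leq_sum => i _.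
exact/ltnW/residue_lt.
Qed.

Lemma widthS k : 2 * width k = width k.+1 + size (leaves k).
Proof.
apply/eqP; rewrite -(eqn_pmul2r Z_gt0) mulnDl -!mulnA -!sum_residue; apply/eqP.
have -> : size (leaves k) = \sum_(i < n) (Z <= 2 * residue k i).
  rewrite size_map size_filter -sum1_count big_mkcond big_enum /=.
  by apply: eq_bigr => i _; case: leqP.
rewrite big_distrr big_distrl -big_split /=.
by apply: eq_bigr => i _; rewrite {1}residueS addnC [Z * _]mulnC.
Qed.

Lemma node_ltn k j : k < m -> j < n -> node k j < n * m.+1.
Proof. by rewrite /node => km jn; nia. Qed.

Lemma node_geq k j : (node k j < n) = false.
Proof. by rewrite /node; apply/negbTE; rewrite -leqNgt mulnS -addnA leq_addr. Qed.

Lemma leaves_lt k l : nth 0 (leaves k) l < n.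
Proof.
case: (ltnP l (size (leaves k))) => [/(mem_nth 0)/mapP[i _ ->]|h].
  exact: ltn_ord.
by rewrite nth_default ?n_gt0.
Qed.

Lemma knuth_yao_root_in : knuth_yao_nodes (node 0 0).
Proof. by apply: node_ltn; rewrite ?n_gt0. Qed.

Lemma knuth_yao_next_in s b :
  knuth_yao_nodes s -> knuth_yao_nodes (knuth_yao_next s b).
Proof.
rewrite /knuth_yao_nodes /knuth_yao_next /=; case: ifP => // _ _.
case: ifP => h; first by apply: node_ltn; rewrite ?ltn_mod // (ltn_trans h) ?width_lt.
by apply: (leq_trans (leaves_lt _ _)); rewrite leq_pmulr.
Qed.

Definition knuth_yao : ddg n :=
  @DDG n knuth_yao_nodes (node 0 0) insub knuth_yao_next
       knuth_yao_root_in knuth_yao_next_in.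

Lemma knuth_yao_label_node k j : ddg_label knuth_yao (node k j) = None.
Proof. by rewrite /= insubF // node_geq. Qed.

Lemma knuth_yao_next_node k j b : j < n ->
  ddg_next knuth_yao (node k j) b =
  if 2 * j + b < width k.+1 then node (k.+1 %% m) (2 * j + b)
  else nth 0 (leaves k) (2 * j + b - width k.+1).
Proof.
move=> jn; rewrite /= /knuth_yao_next node_geq /node [n * _]mulnC.
by rewrite divnMDl ?n_gt0 // modnMDl divn_small // addn0 /= modn_small.
Qed.

Lemma sum_double a (F : nat -> nat) :
  \sum_(0 <= c < 2 * a) F c = \sum_(0 <= j < a) (F (2 * j + false) + F (2 * j + true)).
Proof.
elim: a => [|a IHa]; first by rewrite !big_geq.
rewrite [in RHS]big_nat_recr //= -IHa mulnS addnC.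
by rewrite addnS addn1 !big_nat_recr //= -addnA; congr (_ + (F _ + F _)); lia.
Qed.

(** The induction treats a whole level at once, because the total over a level does not depend on
    how its nodes share the children. *)
Lemma knuth_yao_leaf_sum l k i : k < m ->
  \sum_(0 <= j < width k) leaf_count knuth_yao l (node k j) i =
  (2 ^ l * residue k i) %/ Z.
Proof.
elim: l k => [|l IHl] k km.
  rewrite big1 => [|j _]; first by rewrite mul1n divn_small ?residue_lt.
  by rewrite /leaf_count /state_count /= insubF ?node_geq.
have jn j : j < width k -> j < n by move=> h; apply: ltn_trans (width_lt k).
under eq_big_nat => j /andP[_ hj].
  rewrite /leaf_count state_countS !ddg_step_branch ?knuth_yao_label_node //.
  rewrite !knuth_yao_next_node ?jn //.
over.
rewrite -(sum_double _ (fun c => state_count knuth_yao l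
  (if c < width k.+1 then node (k.+1 %% m) c else nth 0 (leaves k) (c - width k.+1))
  (fun t => ddg_label knuth_yao t == Some i))).
rewrite widthS (@big_cat_nat _ _ _ (width k.+1)) ?leq_addr //=.
(* The new digit accounts for the [2 ^ l] strings below a leaf labelled [i], the new residue for
   those below the branch nodes. *)
have -> : 2 ^ l.+1 * residue k i =
          2 ^ l * (Z <= 2 * residue k i) * Z + 2 ^ l * residue k.+1 i.
  by rewrite expnSr -mulnA {1}residueS mulnDr [Z * _]mulnC mulnA.
rewrite divnMDl // addnC; congr (_ + _); last first.
  (* When [k.+1 = m] the level wraps around to 0; periodicity makes this harmless. *)
  have [wE rE] : width k.+1 = width (k.+1 %% m) /\ residue k.+1 i = residue (k.+1 %% m) i.
    move: km; rewrite leq_eqVlt => /orP[/eqP->|h]; last by rewrite modn_small.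
    by rewrite modnn width_period residue_period.
  rewrite rE -IHl ?ltn_mod // -wE; apply: eq_big_nat => j /andP[_ ->] //.
rewrite -{1}[width k.+1]add0n big_addn addKn.
under eq_big_nat => j _.
  rewrite ltnNge leq_addl /= addnK.
over.
rewrite -(big_nth 0 xpredT (fun t => state_count knuth_yao l t
  (fun t => ddg_label knuth_yao t == Some i))) /leaves big_map big_filter big_enum_cond /=.
under eq_bigr => j _.
  rewrite state_count_leaf /= ?valK //.
over.
rewrite /= big_mkcond (bigD1 i) //= big1 => [|j ji]; last first.
  by case: ifP => // _; case: eqP => // -[e]; rewrite e eqxx in ji.
by rewrite eqxx addn0; case: leqP => _; rewrite ?mul1n ?muln1 ?muln0.
Qed.

Lemma knuth_yao_leaf_count l i :
  leaf_count knuth_yao l (ddg_root knuth_yao) i = (2 ^ l * M i) %/ Z.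
Proof. by rewrite -residue0 -knuth_yao_leaf_sum // width0 big_nat1. Qed.

(** Depth grows along every edge between branch nodes except the back edge into the root, which a
    simple path cannot use. *)
Lemma knuth_yao_simple_path p : simple_path_to_leaf knuth_yao p -> size p <= m.
Proof.
move=> [pp up _].
have gen k j : k < m -> j < n -> path (ddg_edge knuth_yao) (node k j) p ->
    node 0 0 \notin p -> size p <= m - k.
  elim: p k j {pp up} => // y p IHp k j km jn /= /andP[/andP[_ /existsP[b /eqP]]].
  rewrite (knuth_yao_next_node _ _ jn); case: ifP => [c_lt <-|_ <-].
    move: km; rewrite leq_eqVlt => /orP[/eqP km|km].
      move: c_lt; rewrite km width_period width0 modnn ltnS leqn0 => /eqP->.
      by rewrite inE eqxx.
    rewrite modn_small // => /IHp h; rewrite inE negb_or => /andP[_ /h].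
    by move=> /(_ km (ltn_trans c_lt (width_lt _))); lia.
  case: p {IHp} => [|z p]; first by rewrite /=; lia.
  by rewrite /= /ddg_edge /= insubT ?leaves_lt.
rewrite -[X in _ <= X]subn0; case/andP: up => r_notin _.
by apply: (gen 0 0); rewrite ?n_gt0.
Qed.

End OptimalTree.

(** * From counts of strings to probabilities and expectations *)

Section Probability.
Local Open Scope classical_set_scope.
Context (R : realType) (d : measure_display) (Omega : measurableType d)
  (P : probability Omega R) (X : nat -> {RV P >-> bool}).
Hypotheses (X_fair : fair_bits X) (X_indep : independent_bits X).

Definition prefix_event k (F : pred (seq bool)) : set Omega :=
  [set om | F (mkseq (bit_stream X om) k)].

Lemma cylinderE v : prefix_event (size v) (pred1 v) =
  \bigcap_(k in [set` iota 0 (size v)]) (X k @^-1` [set nth false v k]).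
Proof.
apply/seteqP; split=> om /=.
  move=> /eqP e k; rewrite /= mem_iota add0n => /= kv.
  by rewrite -[in RHS]e nth_mkseq.
move=> h; apply/eqP/(@eq_from_nth _ false); rewrite size_mkseq // => k kv.
by rewrite nth_mkseq //; apply: h; rewrite /= mem_iota.
Qed.

Lemma measurable_bit k (B : set bool) : measurable (X k @^-1` B).
Proof. exact: measurable_funPTI. Qed.

Lemma cylinder_measurable v : measurable (prefix_event (size v) (pred1 v)).
Proof.
rewrite cylinderE; apply: bigcap_measurableType => k _; exact: measurable_bit.
Qed.

Lemma cylinder_prob v :
  P (prefix_event (size v) (pred1 v)) = (2^-1 ^+ size v)%:E.
Proof.
rewrite cylinderE X_indep ?iota_uniq // (eq_bigr (fun=> (2^-1)%:E)) => [|k _]; last exact: X_fair.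
by rewrite prodEFin big_const_seq count_predT size_iota iter_mulr_1.
Qed.

(** Fixing a prefix [v] allows an induction on the number [k] of free bits: the event splits into
    two disjoint ones according to the bit after [v]. *)
Lemma prefix_event_cat k F v :
  let E := prefix_event (size v) (pred1 v) `&` prefix_event (size v + k) F in
  measurable E /\
  P E = ((count (fun u => F (v ++ u)) (bitstrings k))%:R * 2^-1 ^+ (size v + k))%:E.
Proof.
elim: k v => [|k IHk] v /=.
  rewrite addn0 cats0 addn0; case Fv: (F v).
    have -> : prefix_event (size v) (pred1 v) `&` prefix_event (size v) F =
              prefix_event (size v) (pred1 v).
      by apply/setIidl => om; rewrite /prefix_event /= => /eqP ->.
    by split; [exact: cylinder_measurable|rewrite cylinder_prob mul1r].
  have -> : prefix_event (size v) (pred1 v) `&` prefix_event (size v) F = set0.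
    by apply/seteqP; split=> om [] //=; rewrite /prefix_event /= => /eqP ->; rewrite Fv.
  by split; [exact: measurable0|rewrite measure0 mul0r].
pose C b := prefix_event (size (rcons v b)) (pred1 (rcons v b)) `&`
            prefix_event (size (rcons v b) + k) F.
have -> : prefix_event (size v) (pred1 v) `&` prefix_event (size v + k.+1) F =
          C false `|` C true.
  apply/seteqP; split=> om; rewrite /C /prefix_event /= !size_rcons !addSnnS !mkseqS !eqseq_rcons.
    by move=> [-> ->]; case: (bit_stream X om _); [right|left].
  by move=> [] [/andP[-> _] ->].
have [mf Pf] := IHk (rcons v false); have [mt Pt] := IHk (rcons v true).
split; first exact: measurableU.
rewrite measureU //; last first.
  apply/seteqP; split=> om //; rewrite /C /prefix_event /= !size_rcons !mkseqS !eqseq_rcons.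
  by case=> -[/andP[_ /eqP->]] _ [/andP[_]].
apply: (eq_trans (congr2 (fun x y => (x + y)%E) Pf Pt)); rewrite -EFinD; congr (_%:E).
rewrite !size_rcons !addSnnS -mulrDl -natrD; congr (_%:R * _).
by rewrite count_cat !count_map; congr (_ + _)%N; apply: eq_count => u /=; rewrite cat_rcons.
Qed.

Lemma prefix_event_measurable k F : measurable (prefix_event k F).
Proof.
have [] := prefix_event_cat k F [::]; rewrite add0n => mE _.
by move: mE; congr measurable; apply/seteqP; split=> om // [].
Qed.

Lemma prefix_event_prob k F :
  P (prefix_event k F) = ((count F (bitstrings k))%:R / 2 ^+ k)%:E.
Proof.
have [_] := prefix_event_cat k F [::]; rewrite add0n -exprVn => <-.
by congr (P _); apply/seteqP; split=> om // [].
Qed.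

Section Tree.
Context (n : nat) (T : ddg n).

Lemma run_event k (Q : pred nat) :
  [set om | Q (ddg_run T (bit_stream X om) k)] =
  prefix_event k (fun w => Q (ddg_exec T (ddg_root T) w)).
Proof. by apply/seteqP; split=> om; rewrite /prefix_event /= ddg_runE. Qed.

Lemma run_event_measurable k (Q : pred nat) :
  measurable [set om | Q (ddg_run T (bit_stream X om) k)].
Proof. rewrite run_event; exact: prefix_event_measurable. Qed.

Lemma run_event_prob k (Q : pred nat) :
  P [set om | Q (ddg_run T (bit_stream X om) k)] =
  ((state_count T k (ddg_root T) Q)%:R / 2 ^+ k)%:E.
Proof. by rewrite run_event prefix_event_prob. Qed.

Lemma expected_bitsE :
  expected_bits X T =
  (\sum_(0 <= k <oo) ((branch_count T k (ddg_root T))%:R / 2 ^+ k)%:E)%E.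
Proof.
pose B k := [set om | ddg_label T (ddg_run T (bit_stream X om) k) == None].
have mB k : measurable (B k) := run_event_measurable k (fun t => ddg_label T t == None).
have -> : expected_bits X T = (\int[P]_om \sum_(0 <= k <oo) (\1_(B k) om)%:E)%E.
  apply: eq_integral => om _; apply: eq_eseriesr => k _.
  by rewrite indicE; congr ((nat_of_bool _)%:R%:E); apply/idP/idP; rewrite inE.
rewrite integral_nneseries //; last first.
- move=> k; exact/measurable_EFinP/measurable_indic.
apply: eq_eseriesr => k _.
rewrite integral_indic // setIT.
exact: (run_event_prob k (fun t => ddg_label T t == None)).
Qed.

(** Since the sampler stays at a leaf, halting with [i] is an increasing union of events depending
    on finitely many bits. *)
Lemma leaf_prob_cvg i :
  (fun k => ((leaf_count T k (ddg_root T) i)%:R / 2 ^+ k)%:E : \bar R)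
    @ \oo --> output_prob X T i.
Proof.
pose F k := [set om | ddg_label T (ddg_run T (bit_stream X om) k) == Some i].
have mF k : measurable (F k) := run_event_measurable k (fun t => ddg_label T t == Some i).
have -> : output_prob X T i = P (\bigcup_k F k).
  congr (P _); apply/seteqP; split=> om /= [k]; first by move=> e; exists k => //; apply/eqP.
  by move=> _ /eqP e; exists k.
have -> : (fun k => ((leaf_count T k (ddg_root T) i)%:R / 2 ^+ k)%:E : \bar R) = P \o F.
  apply/funext => k; apply/esym.
  exact: (run_event_prob k (fun t => ddg_label T t == Some i)).
apply: nondecreasing_cvg_mu => //; first exact: bigcup_measurable.
apply/nondecreasing_seqP => k; apply/subsetPset => om /= /eqP e.
by rewrite /F /= e /= e eqxx.
Qed.

End Tree.
End Probability.

(** * Rounding estimates, and a lemma on paths meeting a cycle *)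

Lemma floor_expansion_bound n (M : 'I_n -> nat) Z k : (0 < Z)%N ->
  Z = (\sum_(i < n) M i)%N -> (2 ^ k <= \sum_(i < n) (2 ^ k * M i) %/ Z + n)%N.
Proof.
move=> Z0 ZM; rewrite -(leq_pmul2r Z0) {1}ZM big_distrr mulnDl big_distrl /=.
have -> : (n * Z = \sum_(i < n) Z)%N by rewrite sum_nat_const card_ord.
rewrite -big_split /=; apply: leq_sum => i _.
by rewrite {1}(divn_eq (2 ^ k * M i) Z) leq_add2l ltnW // ltn_mod.
Qed.

Lemma branch_count_le n (T : ddg n) (M : 'I_n -> nat) Z : (0 < Z)%N ->
  Z = (\sum_(i < n) M i)%N ->
  (forall k i, leaf_count T k (ddg_root T) i = ((2 ^ k * M i) %/ Z)%N) ->
  forall k, (branch_count T k (ddg_root T) <= n)%N.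
Proof.
move=> Z_gt0 Z_sum leaf_countE k; have := branch_leaf_count T k (ddg_root T).
rewrite (eq_bigr (fun i => (2 ^ k * M i) %/ Z)%N) => [|i _]; last exact: leaf_countE.
by have := floor_expansion_bound k Z_gt0 Z_sum => /[swap] e; rewrite -{1}e [leqRHS]addnC leq_add2r.
Qed.

Lemma floor_expansion_cvg (R : realType) (a Z : nat) : (0 < Z)%N ->
  ((fun k => ((2 ^ k * a) %/ Z)%:R / 2 ^+ k : R) @ \oo --> (a%:R / Z%:R : R))%classic.
Proof.
move=> Z0; have ZR : (0 : R) < Z%:R by rewrite ltr0n.
apply: (@squeeze_cvgr _ _ _ _ (fun k => a%:R / Z%:R - 2^-1 ^+ k) (fun=> a%:R / Z%:R)).
- apply: nearW => k; have k0 : (0 : R) < 2 ^+ k by rewrite exprn_gt0.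
  have -> : a%:R / Z%:R = (2 ^ k * a)%:R / Z%:R / 2 ^+ k :> R.
    by rewrite natrM natrX; field; rewrite !gt_eqF.
  rewrite exprVn -[X in _ - X]mul1r -mulrBl !ler_pM2r ?invr_gt0 //.
  rewrite lerBlDr ler_pdivrMr // ler_pdivlMr // -[1]/(1%:R) -natrD -!natrM !ler_nat.
  by rewrite leq_trunc_div andbT addn1 ltnW // ltn_ceil.
- rewrite -[X in (_ --> X)%classic]subr0; apply: cvgB; first exact: cvg_cst.
  by apply: cvg_expr; rewrite ger0_norm; lra.
- exact: cvg_cst.
Qed.

(* Going along [p] until it first meets the cycle, then once around. *)
Lemma path_around_cycle (V : eqType) (e : rel V) r p c0 :
  path e r p -> ucycle e c0 -> last r p \in c0 ->
  exists p' p1 x c, [/\ path e r p', uniq (r :: p'), r :: p' = p1 ++ x :: c,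
    cycle e (x :: c) & size (x :: c) = size c0].
Proof.
move=> pp /andP[cc0 uc0]; case/shortenP: pp => {}p pp up _ lc.
have hp : has (mem c0) (r :: p) by apply/hasP; exists (last r p); rewrite ?mem_last.
have [x [s1 [s2 [E xc0 s1c0]]]] : exists x s1 s2,
    [/\ r :: p = rcons s1 x ++ s2, x \in c0 & ~~ has (mem c0) s1].
  by case: (split_find hp) => x s1 s2; exists x, s1, s2.
have [j c rc] := rot_to xc0.
have cc : cycle e (x :: c) by rewrite -rc rot_cycle.
have uc : uniq (x :: c) by rewrite -rc rot_uniq.
have sc : size (x :: c) = size c0 by rewrite -rc size_rot.
have pc : path e x c by move: cc; rewrite /= rcons_path => /andP[].
have u : uniq (s1 ++ x :: c).
  move: up; rewrite E cat_uniq rcons_uniq => /andP[/andP[_ us1] _].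
  rewrite cat_uniq us1 uc andbT /= -/(has (mem s1) (x :: c)); apply/hasPn => z.
  rewrite -rc mem_rot => zc.
  by apply: contra s1c0 => zs; apply/hasP; exists z.
(* If [s1] is empty, the start [r] itself lies on the cycle. *)
case: s1 E {s1c0} u => [|y s1] [ry E] u.
  by exists c, [::], x, c; split => //; rewrite ry.
exists (s1 ++ x :: c), (y :: s1), x, c; split => //; rewrite ry //.
by move: pp; rewrite E ry !cat_path rcons_path /= pc andbT => /andP[].
Qed.

(** * Long simple paths in every finite optimal tree *)

Section LowerBound.
Local Open Scope classical_set_scope.
Context (R : realType) (n : nat) (T : ddg n) (M : 'I_n -> nat) (Z m : nat).
Hypotheses (Z_prime : prime Z) (Z_gt2 : (2 < Z)%N) (Z_sum : Z = (\sum_(i < n) M i)%N).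
Hypothesis (Z_order : forall a, (0 < a)%N -> (Z %| 2 ^ a - 1)%N -> (m <= a)%N).
Hypothesis (leaf_countE : forall k i,
  leaf_count T k (ddg_root T) i = ((2 ^ k * M i) %/ Z)%N).

Local Notation label := (ddg_label T).
Local Notation next := (ddg_next T).
Local Notation root := (ddg_root T).

Let Z_gt0 : (0 < Z)%N. Proof. exact: prime_gt0. Qed.

Lemma branch_count_full s k : (forall t, reaches T s t -> label t = None) ->
  branch_count T k s = (2 ^ k)%N.
Proof.
elim: k s => [|k IHk] s hs; have es := hs s (reaches_refl T s).
  by rewrite /branch_count /state_count /= es.
rewrite /branch_count state_countS !ddg_step_branch // expnS mul2n -addnn.
by congr (_ + _)%N; apply: IHk => t /(reaches_trans (reaches_next _ es)); apply: hs.
Qed.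

(** With no leaf below [s], all [2 ^ n] continuations by [n] bits would sit at branch nodes of one
    depth, where at most [n] strings do. *)
Lemma reaches_leaf s : reaches T root s ->
  exists2 t, reaches T s t & label t != None.
Proof.
move=> [w hw]; apply/not_exists2P => no_leaf.
have := branch_count_le Z_gt0 Z_sum leaf_countE (size w + n).
have := state_count_exec_le T n w root (fun t => label t == None).
rewrite (trail_exec hw) -/(branch_count T n s) branch_count_full => [h1 h2|t st].
  by have := leq_trans h1 h2; rewrite leqNgt ltn_expl.
by case: (no_leaf t) => // /negP; rewrite negbK => /eqP.
Qed.

(* A leaf below [s] would otherwise be hit twice at one depth, although at most one binary
   digit of [M i / Z] is available there. *)
Lemma trail_size_inj s w w' :
  trail T root w s -> trail T root w' s -> size w = size w' -> w = w'.
Proof.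
move=> hw hw' sw; apply: contrapT => /eqP ww'.
have [t [v hv]] : exists2 t, reaches T s t & label t != None by apply: reaches_leaf; exists w.
case et: (label t) => [i|] // _.
have hit u : trail T root u s -> first_hit T i root (u ++ v).
  by move=> hu; apply: (trail_first_hit (trail_trans hu hv)).
case sk: (size (w ++ v)) => [|k].
  by move: sk ww' sw; rewrite size_cat; case: w {hw} => // _; case: w' {hw'}.
have sk' : size (w' ++ v) = k.+1 by rewrite -sk !size_cat sw.
have : (2 <= count (first_hit T i root) (bitstrings k.+1))%N.
  apply: (@count_ge2 _ _ _ (w ++ v) (w' ++ v)); rewrite ?mem_bitstrings ?sk ?sk' ?hit //.
  by rewrite eqseq_cat // (negbTE ww').
have := leaf_countS T k root i; rewrite !leaf_countE expnS -mulnA.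
set a := (2 ^ k * M i)%N => e c2.
have : ((2 * a) %/ Z < 2 * (a %/ Z) + 2)%N.
  by rewrite ltn_divLR //; have := ltn_ceil a Z_gt0; nia.
by rewrite e ltn_add2l ltnNge c2.
Qed.

(** Two loops at [x] with different first bits, run in either order, would give distinct trails of
    equal length from the root to [x]. *)
Lemma no_two_returns x b : reaches T root x -> label x = None ->
  reaches T (next x b) x -> reaches T (next x (~~ b)) x -> False.
Proof.
move=> [u hu] hx [v hv] [v' hv'].
have hbv : trail T x (b :: v) x by rewrite /= hx.
have hbv' : trail T x (~~ b :: v') x by rewrite /= hx.
have : u ++ (b :: v) ++ ~~ b :: v' = u ++ (~~ b :: v') ++ b :: v.
  apply: (@trail_size_inj x); last by rewrite !size_cat addnA addnAC !addnA.
  - exact: trail_trans hu (trail_trans hbv hbv').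
  - exact: trail_trans hu (trail_trans hbv' hbv).
by move=> /eqP; rewrite eqseq_cat // eqxx /= eqseq_cons; case: b {hbv hbv' hv hv'}.
Qed.

(** The probability of ending with [i] when started at [s], as a limit of counts. *)
Definition leaf_prob i s : R :=
  lim ((fun k => (leaf_count T k s i)%:R / 2 ^+ k : R) @ \oo).

Lemma leaf_prob_cvg_lim i s :
  ((fun k => (leaf_count T k s i)%:R / 2 ^+ k : R) @ \oo --> leaf_prob i s).
Proof.
apply: nondecreasing_is_cvgn.
  apply/nondecreasing_seqP => k; rewrite leaf_countS exprS invfM mulrA.
  rewrite ler_pM2r ?invr_gt0 ?exprn_gt0 //.
  by rewrite ler_pdivlMr // mulrC -natrM ler_nat leq_addr.
exists 1 => _ [k _ <-]; rewrite ler_pdivrMr ?exprn_gt0 // mul1r -natrX ler_nat.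
by rewrite -size_bitstrings count_size.
Qed.

Lemma leaf_prob_leaf i s : label s != None -> leaf_prob i s = (label s == Some i)%:R.
Proof.
move=> hs; apply: cvg_lim => //.
rewrite (_ : (fun _ => _) = fun=> (label s == Some i)%:R); first exact: cvg_cst.
apply/funext => k; rewrite /leaf_count state_count_leaf // natrM natrX mulfK //.
Qed.

Lemma leaf_prob_branch i s b : label s = None ->
  2 * leaf_prob i s = leaf_prob i (next s b) + leaf_prob i (next s (~~ b)).
Proof.
move=> hs; have -> : leaf_prob i (next s b) + leaf_prob i (next s (~~ b)) =
    leaf_prob i (next s false) + leaf_prob i (next s true) by case: b; rewrite // addrC.
pose u k := 2 * ((leaf_count T k.+1 s i)%:R / 2 ^+ k.+1) : R.
have u1 : u @ \oo --> 2 * leaf_prob i s.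
  apply: cvgM; first exact: cvg_cst.
  by have := @leaf_prob_cvg_lim i s; rewrite -cvg_shiftS.
have u2 : u @ \oo --> leaf_prob i (next s false) + leaf_prob i (next s true).
  have -> : u = (fun k => (leaf_count T k (next s false) i)%:R / 2 ^+ k) \+
                (fun k => (leaf_count T k (next s true) i)%:R / 2 ^+ k).
    apply/funext => k; rewrite /u /leaf_count state_countS !ddg_step_branch // natrD exprS /=.
    by field; rewrite expf_neq0.
  by apply: cvgD; apply: leaf_prob_cvg_lim.
by rewrite -(cvg_lim (@Rhausdorff R) u1) (cvg_lim (@Rhausdorff R) u2).
Qed.

Lemma leaf_prob_root i : leaf_prob i root = (M i)%:R / Z%:R.
Proof.
apply: cvg_lim => //.
have -> : (fun k => (leaf_count T k root i)%:R / 2 ^+ k : R) =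
          (fun k => ((2 ^ k * M i) %/ Z)%:R / 2 ^+ k).
  by apply/funext => k; rewrite leaf_countE.
exact: floor_expansion_cvg.
Qed.

(** The non-negative part of the localization of the integers at the prime [Z]; [c] is nonzero
    because [Z] divides 0. *)
Definition Z_integral (x : R) : Prop :=
  exists c e : nat, ~~ (Z %| c)%N /\ c%:R * x = e%:R.

Lemma Z_integral_nat a : Z_integral a%:R.
Proof. by exists 1%N, a; rewrite mul1r dvdn1; split=> //; lia. Qed.

Lemma Z_integralD x y : Z_integral x -> Z_integral y -> Z_integral (x + y).
Proof.
move=> [c [e [hc he]]] [c' [e' [hc' he']]]; exists (c * c')%N, (c' * e + c * e')%N.
rewrite Euclid_dvdM // negb_or hc hc'; split=> //.
by rewrite natrM natrD !natrM -he -he'; ring.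
Qed.

Lemma Z_integralMn a x : Z_integral x -> Z_integral (a%:R * x).
Proof.
move=> [c [e [hc he]]]; exists c, (a * e)%N; split=> //.
by rewrite natrM -he; ring.
Qed.

Lemma Z_integral_div c x : ~~ (Z %| c)%N -> Z_integral (c%:R * x) -> Z_integral x.
Proof.
move=> hc [c' [e [hc' he]]]; exists (c' * c)%N, e.
by rewrite Euclid_dvdM // negb_or hc hc' natrM -mulrA.
Qed.

Lemma Z_integral_frac a : (0 < a < Z)%N -> ~ Z_integral (a%:R / Z%:R).
Proof.
move=> /andP[a0 aZ] [c [e [hc]]] /eqP.
rewrite mulrA -[X in _ == X]divr1 eqr_div ?oner_neq0 ?pnatr_eq0 -?lt0n //.
rewrite mulr1 -!natrM eqr_nat => /eqP ca.
have : (Z %| c * a)%N by rewrite ca dvdn_mull.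
by rewrite Euclid_dvdM // (negbTE hc) /= gtnNdvd.
Qed.

(* Unfolding a closed walk [v] from [s] gives [2 ^ size v * q s = q s + y], where [y] collects
   the branches that leave the walk. *)
Lemma leaf_prob_trail i s v t : trail T s v t ->
  (forall v1 b v2, v = v1 ++ b :: v2 ->
     Z_integral (leaf_prob i (next (ddg_exec T s v1) (~~ b)))) ->
  exists2 y, Z_integral y & (2 ^ size v)%:R * leaf_prob i s = leaf_prob i t + y.
Proof.
elim: v s => [|b v IHv] s /=.
  by move=> /eqP-> _; exists 0; [exact: (Z_integral_nat 0)|rewrite mul1r addr0].
move=> /andP[/eqP hs hv] out.
have [v1 c v2 ev|y iy Ey] := IHv _ hv.
  by have := out (b :: v1) c v2; rewrite ev /= ddg_step_branch //; apply.
exists (y + (2 ^ size v)%:R * leaf_prob i (next s (~~ b))).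
  by apply: Z_integralD => //; apply: Z_integralMn; apply: (out [::] b v).
by rewrite expnSr natrM -mulrA (leaf_prob_branch i b hs) mulrDr Ey addrA.
Qed.

Local Notation edge := (ddg_edge T).

Definition long_cycle := exists c x,
  [/\ ucycle edge c, x \in c, reaches T root x & (m <= size c)%N].

(** Induction on the number of nodes reachable from [s], which drops on moving to a state that
    cannot return. If [s] lies on no cycle, both children are such states; otherwise the exits of a
    shortest closed walk are. *)
Lemma leaf_prob_integral i s : finite_set (ddg_nodes T) -> ~ long_cycle ->
  reaches T root s -> Z_integral (leaf_prob i s).
Proof.
move=> /finite_seqP[A nodesE] no_cycle.
pose B := (\max_(x <- A) x).+1.
have ltB t : reaches T root t -> (t < B)%N.
  move=> /reaches_nodes/(_ (ddg_root_in T)); rewrite nodesE /= => tA.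
  by rewrite ltnS; apply: leq_bigmax_seq.
pose N t := count (fun x => `[<reaches T t x>]) (iota 0 B).
(* All that [u] reaches is reached from [t], and [t] itself is lost. *)
have N_lt t u : reaches T root t -> reaches T t u -> ~ reaches T u t -> (N u < N t)%N.
  move=> rt tu nut; rewrite -addn1.
  have <- : count (pred1 t) (iota 0 B) = 1%N.
    by rewrite count_uniq_mem ?iota_uniq // mem_iota add0n ltB.
  rewrite -count_predUI [X in (_ + X)%N](eq_count (a2 := pred0)) ?count_pred0 ?addn0.
    apply: sub_count => x /= /orP[/asboolP ux|/eqP->]; apply/asboolP; last exact: reaches_refl.
    exact: reaches_trans ux.
  by move=> x /=; apply/negP => /andP[/asboolP ux /eqP xt]; rewrite xt in ux.
have [k] := ubnP (N s); elim: k s => // k IHk s; rewrite ltnS => Nk rs.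
have off t : reaches T s t -> ~ reaches T t s -> Z_integral (leaf_prob i t).
  move=> st nts; apply: IHk (reaches_trans rs st).
  by apply: leq_trans Nk; apply: N_lt.
case es: (label s) => [j|].
  by rewrite leaf_prob_leaf es //; apply: Z_integral_nat.
(* The shift by one excludes the empty walk. *)
pose closed k := `[< exists p, [/\ path edge s p, last s p = s & size p = k.+1] >].
have [exc|noc] := pselect (exists k, closed k); last first.
  have child b : Z_integral (leaf_prob i (next s b)).
    apply: off; first exact: reaches_next.
    move=> /reachesP[p pp lp]; apply: noc; exists (size p); apply/asboolP.
    exists (next s b :: p); split => //=; rewrite pp andbT /ddg_edge es eqxx /=.
    by apply/existsP; exists b.
  apply: (@Z_integral_div 2); first by rewrite gtnNdvd.
  by rewrite (leaf_prob_branch i false es); apply: Z_integralD.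
case: (ex_minnP exc) => a /asboolP[p [pp lp sp]] a_min.
have [w] := path_trail pp; rewrite lp sp => hw sw.
have [v1 b v2 ew|y iy Ey] := leaf_prob_trail (i := i) hw.
  move: hw; rewrite ew trail_cat => /andP[hv1 /= /andP[/eqP ex hv2]].
  set x := ddg_exec T s v1 in hv1 ex hv2 *.
  have sx : reaches T s x by exists v1.
  have bx : reaches T (next x b) x by apply: reaches_trans sx; exists v2.
  apply: off; first exact: reaches_trans sx (reaches_next _ ex).
  by move=> /reaches_trans/(_ sx); apply: no_two_returns bx => //; apply: reaches_trans sx.
have {Ey} Ey : (2 ^ a.+1 - 1)%:R * leaf_prob i s = y.
  by rewrite natrB ?expn_gt0 // mulrBl -sw Ey mul1r addrAC subrr add0r.
apply: (@Z_integral_div (2 ^ a.+1 - 1)); last by rewrite Ey.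
apply/negP => Zdiv; apply: no_cycle.
case/lastP: p pp lp sp => // c x; rewrite last_rcons size_rcons rcons_path => /andP[pc ex] xs [sc].
rewrite xs in ex.
exists (s :: c), s; split; rewrite ?mem_head //; last by rewrite /= sc; apply: Z_order.
rewrite /ucycle /= rcons_path pc ex /=.
(* Removing repetitions from [c] still leaves a closed walk, so by minimality of [a] there were
   none. *)
case/shortenP: (pc) (ex) => c' pc' uc' sub ex'.
rewrite -/(uniq (s :: c)); apply: (leq_size_uniq uc') => [z|].
  by rewrite !inE => /orP[->//|/sub ->]; rewrite orbT.
rewrite /= ltnS sc; apply: a_min; apply/asboolP; exists (rcons c' s).
by rewrite rcons_path pc' ex' last_rcons size_rcons.
Qed.

(* Once the path has gone around a long cycle, the other child of its last node never comes
   back to it, so the path can be completed to a simple path ending in a leaf. *)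
Lemma long_cycle_simple_path : long_cycle ->
  exists2 p, simple_path_to_leaf T p & (m <= size p)%N.
Proof.
move=> [c0 [x0 [cc0 x0c /reachesP[p0 pp0 lp0] sc0]]].
have lp0c : last root p0 \in c0 by rewrite lp0.
have [p [p1 [x [c [pp up Ep cc sc]]]]] := path_around_cycle pp0 cc0 lp0c.
have Elast : last root p = last x c.
  by rewrite -[last root p]/(last root (root :: p)) Ep last_cat.
move: cc; rewrite /= rcons_path; set y := last x c in Elast * => /andP[pc].
move=> /andP[/eqP ey /existsP[b /eqP eb]].
have ry : reaches T root y by apply/reachesP; exists p.
have yy : reaches T (next y b) y by rewrite eb; apply/reachesP; exists c.
set o := next y (~~ b).
have noy : ~ reaches T o y by move=> oy; apply: (no_two_returns ry ey yy oy).
have yo : reaches T y o by apply: reaches_next.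
have [t /reachesP[q0 pq0 lq0] lt] := reaches_leaf (reaches_trans ry yo).
case/shortenP: pq0 lq0 => q pq uq _ lq.
exists (p ++ o :: q); last first.
  (* A cycle of [m] nodes guarantees only [m - 1] edges in [p]; the edge into [o] supplies one
     more. *)
  rewrite size_cat /= addnS -addSn; apply: leq_trans (leq_addr _ _).
  by rewrite (leq_trans sc0) // -sc -[(size p).+1]/(size (root :: p)) Ep size_cat leq_addl.
split.
- rewrite cat_path pp /= pq andbT Elast /ddg_edge ey eqxx /=.
  by apply/existsP; exists (~~ b).
(* A node common to both pieces would be reached from [o] and lead along [p] back to [y]. *)
- rewrite -cat_cons cat_uniq up uq andbT /= -/(has (mem (root :: p)) (o :: q)).
  apply/hasPn => z zq; apply/negP => /= zp; apply: noy.
  have oz : reaches T o z.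
    case/splitPl: zq pq => q1 q2 lz; rewrite cat_path => /andP[pq1 _].
    by apply/reachesP; exists q1.
  apply: reaches_trans oz _; rewrite -Elast.
  case/splitPl: zp pp => p2 p3 lz; rewrite cat_path last_cat lz => /andP[_ pp3].
  by apply/reachesP; exists p3.
- by rewrite last_cat /= lq; apply/eqP.
Qed.

Lemma long_simple_path i : finite_set (ddg_nodes T) -> (0 < M i < Z)%N ->
  exists2 p, simple_path_to_leaf T p & (m <= size p)%N.
Proof.
move=> finT Mi; apply: long_cycle_simple_path; apply: contrapT => no_cycle.
apply: (Z_integral_frac Mi); rewrite -leaf_prob_root.
exact: leaf_prob_integral (reaches_refl T root).
Qed.

End LowerBound.

(** * Entropy-optimality forces the binary digits *)

Section EntropyOptimal.
Context (R : realType) (d : measure_display) (Omega : measurableType d)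
  (P : probability Omega R) (X : nat -> {RV P >-> bool}).
Hypotheses (X_fair : fair_bits X) (X_indep : independent_bits X).
Context (n : nat) (M : 'I_n -> nat) (Z : nat).
Hypotheses (Z_gt0 : (0 < Z)%N) (Z_sum : Z = (\sum_(i < n) M i)%N).

Local Notation p := (fun i => (M i)%:R / Z%:R : R).
Local Notation digits k i := ((2 ^ k * M i) %/ Z)%N.

(** The normalized counts increase to the output probability, so they never exceed it; integrality
    gives the floor. *)
Lemma leaf_count_le (T : ddg n) i : output_prob X T i = (p i)%:E ->
  forall k, (leaf_count T k (ddg_root T) i <= digits k i)%N.
Proof.
move=> Ti k.
pose u k := ((leaf_count T k (ddg_root T) i)%:R / 2 ^+ k)%:E : \bar R.
have u_cvg : (u @ \oo --> (p i)%:E)%classic by rewrite -Ti; apply: leaf_prob_cvg.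
have u_nd : nondecreasing_seq u.
  apply/nondecreasing_seqP => j; rewrite lee_fin leaf_countS exprS invfM mulrA.
  by rewrite ler_pM2r ?invr_gt0 ?exprn_gt0 // ler_pdivlMr // mulrC -natrM ler_nat leq_addr.
have : (u k <= (p i)%:E)%E.
  have := ereal_nondecreasing_cvgn u_nd => /(cvg_unique _ u_cvg) -> //.
  by apply: ereal_sup_ubound; exists k.
rewrite lee_fin ler_pdivrMr ?exprn_gt0 // mulrAC ler_pdivlMr ?ltr0n //.
by rewrite -natrX -!natrM ler_nat leq_divRL // [(2 ^ k * _)%N]mulnC.
Qed.

Lemma output_prob_digits (T : ddg n) :
  (forall k i, leaf_count T k (ddg_root T) i = digits k i) ->
  forall i, output_prob X T i = (p i)%:E.
Proof.
move=> Tdig i.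
have h : ((fun k => ((leaf_count T k (ddg_root T) i)%:R / 2 ^+ k)%:E : \bar R)
    @ \oo --> output_prob X T i)%classic by apply: leaf_prob_cvg.
rewrite -(cvg_lim (@ereal_hausdorff R) h); apply: (cvg_lim (@ereal_hausdorff R)).
have -> : (fun k => ((leaf_count T k (ddg_root T) i)%:R / 2 ^+ k)%:E) =
          EFin \o (fun k => (digits k i)%:R / 2 ^+ k : R).
  by apply/funext => k; rewrite Tdig.
by apply/cvg_EFin; [exact: nearW|exact: floor_expansion_cvg].
Qed.

Lemma leq_branch_count (T T' : ddg n) k :
  (forall i, leaf_count T' k (ddg_root T') i <= leaf_count T k (ddg_root T) i)%N ->
  (branch_count T k (ddg_root T) <= branch_count T' k (ddg_root T'))%N.
Proof.
move=> le; have := branch_leaf_count T k (ddg_root T).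
rewrite -(branch_leaf_count T' k (ddg_root T')) => e.
rewrite -(leq_add2r (\sum_(i < n) leaf_count T' k (ddg_root T') i)) -e leq_add2l.
by apply: leq_sum => i _.
Qed.

Context (K : ddg n).
Hypothesis (K_digits : forall k i, leaf_count K k (ddg_root K) i = digits k i).

(** Attaining every leaf bound minimizes each branch count, hence the series for the expected bits
    term by term. *)
Lemma digits_optimal_sampler : optimal_sampler_for X p K.
Proof.
split=> [T TK|]; last exact: output_prob_digits.
rewrite !expected_bitsE //; apply: lee_nneseries => [k _ _|k _].
  by rewrite lee_fin divr_ge0 // exprn_ge0.
rewrite lee_fin ler_pM2r ?invr_gt0 ?exprn_gt0 // ler_nat.
apply: leq_branch_count => i; rewrite K_digits; apply: leaf_count_le.
by rewrite TK output_prob_digits.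
Qed.

(** Without finiteness, a strict inequality in one term would not show in the sum. *)
Lemma digits_expected_bits_fin : (expected_bits X K < +oo)%E.
Proof.
rewrite expected_bitsE //; apply: (@le_lt_trans _ _ (2 * n)%:R%:E); last exact: ltry.
apply: lime_le.
  by apply: is_cvg_nneseries => k _ _; rewrite lee_fin divr_ge0 // exprn_ge0.
apply: nearW => N; rewrite sumEFin lee_fin.
(* This is the partial sum of the geometric series with terms [n / 2 ^ k]. *)
apply: (@le_trans _ _ (n%:R * (2 - 2 / 2 ^+ N))).
  elim: N => [|N IHN]; first by rewrite big_geq // expr0 divr1 subrr mulr0.
  rewrite big_nat_recr //=; apply: (@le_trans _ _ (n%:R * (2 - 2 / 2 ^+ N) + n%:R / 2 ^+ N)).
    rewrite lerD // ler_pM2r ?invr_gt0 ?exprn_gt0 // ler_nat.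
    exact: (branch_count_le Z_gt0 Z_sum K_digits).
  by rewrite le_eqVlt; apply/orP; left; apply/eqP; rewrite exprS; field; apply: expf_neq0.
by rewrite natrM [leRHS]mulrC ler_wpM2l // gerBl divr_ge0 // exprn_ge0.
Qed.

(** A surplus of branch strings at a single depth would cost strictly more than the finite
    expectation of [K]. So branch counts agree, and leaf counts bounded termwise with equal sums
    agree too. *)
Lemma optimal_sampler_digits (T : ddg n) : optimal_sampler_for X p T ->
  forall k i, leaf_count T k (ddg_root T) i = digits k i.
Proof.
move=> [Topt Tp].
have le_dig k i : (leaf_count T k (ddg_root T) i <= digits k i)%N by apply: leaf_count_le.
pose t k := (branch_count T k (ddg_root T))%:R / 2 ^+ k : R.
pose o k := (branch_count K k (ddg_root K))%:R / 2 ^+ k : R.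
have o_ge0 k : 0 <= o k by rewrite divr_ge0 // exprn_ge0.
have ot k : o k <= t k.
  rewrite ler_pM2r ?invr_gt0 ?exprn_gt0 // ler_nat; apply: leq_branch_count => i.
  by rewrite K_digits.
have to k : t k = o k.
  apply/eqP; rewrite eq_le ot andbT leNgt; apply/negP => lt_ot.
  have [_ Kp] := digits_optimal_sampler.
  have := Topt K (fun i => etrans (Kp i) (esym (Tp i))).
  apply/negP; rewrite -ltNge.
  have := digits_expected_bits_fin; rewrite !expected_bitsE //.
  (* Isolating the term [k] keeps the inequality strict after summation. *)
  have split_k (f : nat -> R) : (forall j, 0 <= f j) ->
      (\sum_(0 <= j <oo) (f j)%:E = (f k)%:E + \sum_(0 <= j <oo | j != k) (f j)%:E)%E.
    move=> f0; rewrite (nneseriesD1 (n := k) (P := xpredT)) // => j _.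
    by rewrite lee_fin; exact: f0.
  have t_ge0 j : 0 <= t j := le_trans (o_ge0 j) (ot j).
  rewrite (split_k o o_ge0) (split_k t t_ge0) => finK.
  apply: lte_leD; rewrite ?lte_fin //; last first.
    by apply: lee_nneseries => [j _ _|j _]; rewrite lee_fin; [exact: o_ge0|exact: ot].
  rewrite ge0_fin_numE; last by apply: nneseries_ge0 => j _ _; rewrite lee_fin; exact: o_ge0.
  by apply: le_lt_trans finK; rewrite leeDr // lee_fin; exact: o_ge0.
move=> k i; have /eqP := to k.
rewrite /t /o (can_eq (mulfVK _)) ?expf_neq0 // eqr_nat => /eqP e.
have eqs : (\sum_(j < n) leaf_count T k (ddg_root T) j =
            \sum_(j < n) leaf_count K k (ddg_root K) j)%N.
  by apply: (@addnI (branch_count T k (ddg_root T))); rewrite {2}e !branch_leaf_count.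
apply/eqP; rewrite eqn_leq le_dig -K_digits /=.
have le_K j : (leaf_count T k (ddg_root T) j <= leaf_count K k (ddg_root K) j)%N.
  by rewrite K_digits.
rewrite leqNgt; apply/negP => lt_i; move: eqs.
rewrite (bigD1 i) //= [in RHS](bigD1 i) //= => eqs.
suff : (leaf_count T k (ddg_root T) i + \sum_(j < n | j != i) leaf_count T k (ddg_root T) j <
        leaf_count K k (ddg_root K) i + \sum_(j < n | j != i) leaf_count K k (ddg_root K) j)%N.
  by rewrite eqs ltnn.
by rewrite -addSn leq_add //; apply: leq_sum => j _.
Qed.

End EntropyOptimal.

(** * Combining both bounds at the period [Z - 1] *)

Theorem theorem3p6 (R : realType) (d : measure_display)
    (Omega : measurableType d) (P : probability Omega R)
    (X : nat -> {RV P >-> bool})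
    (X_fair : fair_bits X) (X_indep : independent_bits X)
    (n : nat) (n_ge2 : (2 <= n)%N)
    (M : 'I_n -> nat) (M_gt0 : forall i, (0 < M i)%N)
    (Z : nat) (Z_sum : Z = (\sum_(i < n) M i)%N)
    (Z_prime : prime Z) (Z_root : primitive_root_modulo 2 Z) :
  minimal_optimal_precision X (fun i => (M i)%:R / Z%:R : R) (Z - 1)%N.
Proof.
have Z_gt0 := prime_gt0 Z_prime; have Z_gt1 := prime_gt1 Z_prime.
(* Turns the order of 2 in the residue ring into divisibility. *)
have two_pow a : (2%:R ^+ a == 1 :> 'Z_Z) = (Z %| 2 ^ a - 1)%N.
  have val1 : val (1 : 'Z_Z) = (1 %% Z)%N := val_Zp_nat Z_gt1 1.
  have val2 : val ((2 ^ a)%:R : 'Z_Z) = (2 ^ a %% Z)%N := val_Zp_nat Z_gt1 (2 ^ a).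
  by rewrite -natrX -val_eqE val1 val2 eqn_mod_dvd ?expn_gt0.
have m_gt0 : (0 < Z - 1)%N by rewrite subn_gt0.
have Z_root' : (Z - 1).-primitive_root (2%:R : 'Z_Z).
  by move: Z_root; rewrite /primitive_root_modulo totient_prime // subn1.
have Z_period : (Z %| 2 ^ (Z - 1) - 1)%N by rewrite -two_pow prim_expr_order.
have Z_order a : (0 < a)%N -> (Z %| 2 ^ a - 1)%N -> (Z - 1 <= a)%N.
  by move=> a0; rewrite -two_pow -(prim_order_dvd Z_root') => /dvdn_leq; apply.
(* For [Z = 2] the period statement would say that 2 divides 1. *)
have Z_gt2 : (2 < Z)%N.
  rewrite ltn_neqAle Z_gt1 andbT; apply/eqP => Z2; move: Z_period.
  by rewrite -Z2.
(* As [n] is at least 2, some other positive summand remains. *)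
have M_lt i : (M i < Z)%N.
  have [j ji] : exists j, j != i.
    have n1 : (1 < #|'I_n|)%N by rewrite card_ord.
    have [x [y [_ _ xy]]] := card_gt1P n1.
    by case: (eqVneq x i) xy => [->|xi] yi; [exists y; rewrite eq_sym|exists x].
  rewrite Z_sum (bigD1 i) //= (bigD1 j) //= -[X in (X < _)%N]addn0 ltn_add2l.
  by rewrite addn_gt0 M_gt0.
pose i0 : 'I_n := Ordinal (ltnW n_ge2).
have long (T : ddg n) : optimal_sampler_for X (fun i => (M i)%:R / Z%:R : R) T ->
    finite_set (ddg_nodes T) -> exists2 p, simple_path_to_leaf T p & (Z - 1 <= size p)%N.
  move=> Topt finT; apply: (long_simple_path R Z_prime Z_gt2 Z_sum Z_order _ (i := i0)) => //.
    exact: (optimal_sampler_digits _ _ _ _ (knuth_yao_leaf_count m_gt0 Z_gt0 Z_sum M_lt Z_period)).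
  by rewrite M_gt0 M_lt.
split=> [|T k Topt [finT _ Tmax]]; last first.
  by have [p sp lp] := long T Topt finT; apply: leq_trans lp (Tmax p sp).
pose K := knuth_yao m_gt0 Z_gt0 Z_sum Z_period.
have Kopt : optimal_sampler_for X (fun i => (M i)%:R / Z%:R : R) K.
  by apply: digits_optimal_sampler => //; apply: knuth_yao_leaf_count.
have finK : finite_set (ddg_nodes K) by apply: finite_II.
have Kmax p : simple_path_to_leaf K p -> (size p <= Z - 1)%N.
  by apply: knuth_yao_simple_path.
exists K => //; split => //.
have [p sp lp] := long K Kopt finK; exists p => //.
by apply/eqP; rewrite eqn_leq lp Kmax.
Qed.
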